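(* Given positive integers $\ell$ and $m$, let $\mathbf{r}=(m\ell,m\ell+m,m\ell+2m)$ and let $S(\mathbf{r})$ be the generic semigroup adapted to $\mathbf{r}$. For every $m$ and every $\epsilon>0$, for all $\ell$ sufficiently large (depending on $m$ and $\epsilon$), we have $$g(S(\mathbf{r}))>\left(\frac{(2m)^{3/2}}{3}-\epsilon\right)\ell^{3/2}.$$
   Context: $\mathbb{N}=\{0,1,2,\dots\}$. $v_t$ is the $t$-adic valuation on $\mathbb{C}[[t]]$. The genus $g(S)$ of a numerical semigroup $S$ is the cardinality of $\mathbb{N}\setminus S$. Generic semigroup adapted to $\mathbf{r}=(r_1,r_2,r_3)$ with $0<r_1<r_2<r_3$: let $f_i(t)=\sum_{n\ge r_i} a_{i,n}t^n\in\mathbb{C}[[t]]$ $(i=1,2,3)$ be power series with fixed nonzero lowest-order coefficients $a_{i,r_i}$ and generic higher-order coefficients, i.e. the coefficients $a_{i,n}$ with $n>r_i$, $i=1,2,3$, are algebraically independent over $\mathbb{Q}(a_{1,r_1},a_{2,r_2},a_{3,r_3})$. The generic semigroup adapted to $\mathbf{r}$ is $S(\mathbf{r})=\{v_t(G(f_1,f_2,f_3)) : G\in\mathbb{C}[x_1,x_2,x_3],\ G(f_1,f_2,f_3)\ne 0\}$. *)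

(* Defs.v *)
From HB Require Import structures.
From mathcomp Require Import all_boot all_order all_algebra.
From mathcomp Require Import finmap.
From mathcomp Require Import boolp classical_sets cardinality.
From mathcomp Require Import complex.
(* The notations of this file clash with those of MathComp-Analysis. *)
From mathcomp.multinomials Require Import -(notations) mpoly.

Set Implicit Arguments.
Unset Strict Implicit.
Unset Printing Implicit Defensive.

Import GRing.Theory.
Local Open Scope ring_scope.
Local Open Scope classical_set_scope.

(* The ring K[[t]]: [f n] is the coefficient of t^n in [f]. *)
Definition fps (K : Type) : Type := nat -> K.

Section FpsRing.
Variable K : comNzRingType.
Implicit Types f g h : fps K.

HB.instance Definition _ := gen_eqMixin (fps K).
HB.instance Definition _ := gen_choiceMixin (fps K).

Definition fps_opp f : fps K := fun n => - f n.
Definition fps_add f g : fps K := fun n => f n + g n.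
Definition fps_mul f g : fps K := fun n => \sum_(i < n.+1) f i * g (n - i)%N.
Definition fpsC (c : K) : fps K := fun n => if n == 0%N then c else 0.

Fact fps_addA : associative fps_add.
Proof. by move=> f g h; apply/funext => n; apply: addrA. Qed.

Fact fps_addC : commutative fps_add.
Proof. by move=> f g; apply/funext => n; apply: addrC. Qed.

Fact fps_add0 : left_id (fpsC 0) fps_add.
Proof. by move=> f; apply/funext => n; rewrite /fps_add /fpsC if_same add0r. Qed.

Fact fps_addN : left_inverse (fpsC 0) fps_opp fps_add.
Proof.
by move=> f; apply/funext => n; rewrite /fps_add /fps_opp /fpsC if_same addNr.
Qed.

HB.instance Definition _ :=
  GRing.isZmodule.Build (fps K) fps_addA fps_addC fps_add0 fps_addN.

Definition fps_trunc N f : {poly K} := \poly_(i < N) f i.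

Fact fps_mulE N f g n : (n < N)%N ->
  fps_mul f g n = (fps_trunc N f * fps_trunc N g)`_n.
Proof.
move=> ltnN; rewrite coefM; apply: eq_bigr => -[i /=]; rewrite ltnS => lein _.
by rewrite !coef_poly (leq_ltn_trans lein) // (leq_ltn_trans (leq_subr _ _)).
Qed.

Fact fps_mulC : commutative fps_mul.
Proof. by move=> f g; apply/funext => n; rewrite !(@fps_mulE n.+1) // mulrC. Qed.

Fact fps_mulA : associative fps_mul.
Proof.
move=> f g h; apply/funext => n.
have E f1 g1 h1 : fps_mul f1 (fps_mul g1 h1) n =
    (fps_trunc n.+1 f1 * (fps_trunc n.+1 g1 * fps_trunc n.+1 h1))`_n.
  rewrite coefM; apply: eq_bigr => -[i /= ltin] _.
  by rewrite coef_poly ltin (@fps_mulE n.+1) // ltnS leq_subr.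
by rewrite (fps_mulC (fps_mul f g)) !E mulrA [in RHS]mulrC.
Qed.

Fact fps_mul1 : left_id (fpsC 1) fps_mul.
Proof.
move=> f; apply/funext => n; rewrite /fps_mul big_ord_recl big1 => [|i _].
  by rewrite /fpsC /= mul1r addr0 subn0.
by rewrite /fpsC /= mul0r.
Qed.

Fact fps_mulDl : left_distributive fps_mul fps_add.
Proof.
move=> f g h; apply/funext => n.
by rewrite /fps_mul /fps_add -big_split; apply: eq_bigr => i _; rewrite mulrDl.
Qed.

Fact fps_oner_neq0 : fpsC 1 != 0 :> fps K.
Proof.
by apply/eqP => /(congr1 (fun f : fps K => f 0%N)) /eqP; rewrite oner_eq0.
Qed.

HB.instance Definition _ := GRing.Zmodule_isComNzRing.Build (fps K)
  fps_mulA fps_mulC fps_mul1 fps_mulDl fps_oner_neq0.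

(* The t-adic valuation; it is only meaningful on nonzero series, and the value
   0 at the zero series is a junk value. *)
Definition fps_val f : nat :=
  if pselect (exists n, f n != 0) is left ex then ex_minn ex else 0%N.

Definition fps_eval n (f : 'I_n -> fps K) (G : mpoly n K) : fps K :=
  mmap fpsC f G.

End FpsRing.

Definition generated_subfield (K : fieldType) (A : set K) : set K :=
  smallest (fun F : set K => GRing.divring_closed (fun x => x \in F)) A.

(* The elements [a x], for [x] in [D], are algebraically independent over [F]
   (as a family, so in particular they are pairwise distinct). *)
Definition alg_independent (K : fieldType) (F : set K) (I : Type) (D : set I)
    (a : I -> K) : Prop :=
  forall (k : nat) (s : 'I_k -> I), injective s -> (forall j, D (s j)) ->
  forall p : mpoly k K, (forall u, F (mcoeff u p)) ->
    meval (fun j => a (s j)) p = 0 -> p = 0.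

Definition generic_series (K : fieldType) (r : 'I_3 -> nat)
    (f : 'I_3 -> fps K) : Prop :=
  [/\ forall i n, (n < r i)%N -> f i n = 0,
      forall i, f i (r i) != 0
    & alg_independent (generated_subfield (range (fun i => f i (r i))))
        [set x : 'I_3 * nat | (r x.1 < x.2)%N] (fun x => f x.1 x.2)].

Definition value_semigroup (K : fieldType) (f : 'I_3 -> fps K) : set nat :=
  [set fps_val (fps_eval f G) | G in [set G | fps_eval f G != 0]].

(* [fset_set] sends an infinite set to the empty one, so a positive lower bound
   on [genus S] includes the finiteness of the complement of [S]. *)
Definition genus (S : set nat) : nat := #|` fset_set (~` S)|.

(* Main.v *)
From HB Require Import structures.
Require Import Defs.
From mathcomp Require Import all_boot all_order all_algebra.
From mathcomp Require Import boolp cardinality.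
From mathcomp.multinomials Require Import -(notations) mpoly.
From mathcomp Require Import classical_sets reals exp complex.
From mathcomp Require Import zify ring lra.

(** The series f_1, f_2, f_3 have orders m l, m l + m and m l + 2 m, all at least
m l.  Two facts about the value semigroup S give the bound.

Upper bound on the number of small values.  A monomial of degree larger than d
in the f_i vanishes below N := (d + 1) m l, so modulo t^N the algebra generated
by the f_i is spanned by the 'C(d + 3, 3) monomials of degree at most d.  Series
with pairwise distinct orders below N are linearly independent modulo t^N, so S
has at most 'C(d + 3, 3) elements below N ([card_value_semigroup_le]), hence at
least N - 'C(d + 3, 3) gaps.  This count holds for every d; since it is roughly
d m l - d^3 / 6, the best choice is d about sqrt (2 m l), which gives
(2 m l)^(3/2) / 3 up to an error O(m l), negligible against eps l^(3/2)
([asymptotic_bound]).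

Finiteness of the set of gaps.  This is where genericity enters.  The series
f_1^(l+1) and f_2^l both have order p := (l + 1) m l; subtracting suitable
multiples cancels the coefficients of t^p, and the coefficient of t^(p+1) in
the difference is a nontrivial linear form, over the field generated by the
lowest coefficients, in the second coefficients of f_1 and f_2; it is nonzero
by algebraic independence ([generic_value_next]).  So S contains the
consecutive integers p and p + 1, and therefore every large integer
([value_semigroup_cofinite]). *)

Set Implicit Arguments.
Unset Strict Implicit.
Unset Printing Implicit Defensive.

Import Order.TTheory GRing.Theory Num.Theory.
Local Open Scope ring_scope.

(** * Orders and initial coefficients of power series *)

Definition vanishes_below {K : nzRingType} (n : nat) (f : fps K) : Prop :=
  forall k, (k < n)%N -> f k = 0.

Lemma fpsME (K : comNzRingType) (f g : fps K) n :
  (f * g) n = \sum_(i < n.+1) f i * g (n - i)%N.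
Proof. by []. Qed.

Lemma fpsDE (K : comNzRingType) (f g : fps K) n : (f + g) n = f n + g n.
Proof. by []. Qed.

Lemma fpsNE (K : comNzRingType) (f : fps K) n : (- f) n = - f n.
Proof. by []. Qed.

Lemma fps0E (K : comNzRingType) n : (0 : fps K) n = 0.
Proof. by rewrite -[0 in LHS]/(fpsC 0) /fpsC if_same. Qed.

Lemma fpsCME (K : comNzRingType) c (f : fps K) n : (fpsC c * f) n = c * f n.
Proof.
rewrite fpsME big_ord_recl big1 => [|i _]; last by rewrite /fpsC /= mul0r.
by rewrite addr0 subn0.
Qed.

Lemma fps_sumE (K : comNzRingType) (I : Type) (r : seq I) (F : I -> fps K) n :
  (\sum_(i <- r) F i) n = \sum_(i <- r) F i n.
Proof.
by apply: (big_morph (fun f : fps K => f n)) => //; apply: fps0E.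
Qed.

(** The general theory of polynomial evaluation applies to [fps_eval] only once
[fpsC] is known to be a ring morphism. *)
Lemma fpsC_is_zmod_morphism (K : comNzRingType) : zmod_morphism (@fpsC K).
Proof.
move=> a b; apply/funext => n; rewrite fpsDE fpsNE /fpsC.
by case: ifP => // _; rewrite subr0.
Qed.

Lemma fpsC_is_monoid_morphism (K : comNzRingType) : monoid_morphism (@fpsC K).
Proof.
split=> // a b; apply/funext => n; rewrite fpsCME /fpsC.
by case: ifP => // _; rewrite mulr0.
Qed.

HB.instance Definition _ (K : comNzRingType) :=
  GRing.isZmodMorphism.Build K (fps K) (@fpsC K) (@fpsC_is_zmod_morphism K).
HB.instance Definition _ (K : comNzRingType) :=
  GRing.isMonoidMorphism.Build K (fps K) (@fpsC K) (@fpsC_is_monoid_morphism K).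

Lemma fps_evalM (K : comNzRingType) n (f : 'I_n -> fps K) G H :
  fps_eval f (G * H) = fps_eval f G * fps_eval f H.
Proof. by rewrite /fps_eval -rmorphM. Qed.

Lemma vanishes_belowM (K : comNzRingType) r s (f g : fps K) :
  vanishes_below r f -> vanishes_below s g -> vanishes_below (r + s) (f * g).
Proof.
move=> f0 g0 k lt_k; rewrite fpsME big1 // => -[i /= lt_i] _.
have [/f0->|le_ri] := ltnP i r; first by rewrite mul0r.
by rewrite g0 ?mulr0 //; lia.
Qed.

Lemma vanishes_belowX (K : comNzRingType) r (f : fps K) n :
  vanishes_below r f -> vanishes_below (n * r) (f ^+ n).
Proof.
move=> f0; elim: n => [k|n IHn]; first by rewrite mul0n.
by rewrite exprS mulSn; apply: vanishes_belowM.
Qed.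

Lemma fpsM_lead (K : comNzRingType) r s (f g : fps K) :
  vanishes_below r f -> vanishes_below s g -> (f * g) (r + s)%N = f r * g s.
Proof.
move=> f0 g0; have lt_r : (r < (r + s).+1)%N by lia.
rewrite fpsME (bigD1 (Ordinal lt_r)) //= addKn big1 ?addr0 // => -[i /= lt_i].
rewrite -val_eqE /= => ne_ir; have [/f0->|le_ri] := ltnP i r.
  by rewrite mul0r.
by rewrite g0 ?mulr0 //; lia.
Qed.

(** Beyond the lowest coefficient, one more coefficient is tracked: it is the
one that survives when two series with the same lowest term are subtracted. *)
Lemma fpsM_next (K : comNzRingType) r s (f g : fps K) :
  vanishes_below r f -> vanishes_below s g ->
  (f * g) (r + s).+1 = f r * g s.+1 + f r.+1 * g s.
Proof.
move=> f0 g0; have lt_r : (r < (r + s).+2)%N by lia.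
have lt_r1 : (r.+1 < (r + s).+2)%N by lia.
rewrite fpsME (bigD1 (Ordinal lt_r)) //= (bigD1 (Ordinal lt_r1)) /=; last first.
  by rewrite -val_eqE /= eqn_leq ltnn.
have -> : ((r + s).+1 - r = s.+1)%N by lia.
have -> : ((r + s).+1 - r.+1 = s)%N by lia.
rewrite addrA big1 ?addr0 // => -[i /= lt_i].
rewrite -!val_eqE /= => /andP[ne_ir ne_ir1]; have [/f0->|le_ri] := ltnP i r.
  by rewrite mul0r.
by rewrite g0 ?mulr0 //; lia.
Qed.

Lemma fpsX_lead (K : comNzRingType) r (f : fps K) n :
  vanishes_below r f -> (f ^+ n) (n * r)%N = f r ^+ n.
Proof.
move=> f0; elim: n => [|n IHn]; first by rewrite mul0n !expr0.
by rewrite !exprS mulSn fpsM_lead ?IHn //; apply: vanishes_belowX.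
Qed.

Lemma fpsX_next (K : comNzRingType) r (f : fps K) n :
  vanishes_below r f ->
  (f ^+ n.+1) (n.+1 * r).+1 = n.+1%:R * f r ^+ n * f r.+1.
Proof.
move=> f0; elim: n => [|n IHn]; first by rewrite mul1n !expr1 expr0 !mul1r.
rewrite exprS mulSn fpsM_next //; last exact: vanishes_belowX.
rewrite IHn fpsX_lead // [n.+2%:R]mulrS exprS; ring.
Qed.

Lemma fps_val_eq (K : comNzRingType) n (f : fps K) :
  vanishes_below n f -> f n != 0 -> fps_val f = n.
Proof.
move=> f0 fn; rewrite /fps_val; case: pselect => [ex|[]]; last by exists n.
case: ex_minnP => k fk le_k; apply/eqP; rewrite eqn_leq le_k //= leqNgt.
by apply/negP => /f0/eqP; apply/negP.
Qed.

Lemma fps_valP (K : comNzRingType) (f : fps K) :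
  f != 0 -> vanishes_below (fps_val f) f /\ f (fps_val f) != 0.
Proof.
move=> f_neq0; rewrite /fps_val; case: pselect => [ex|nex].
  case: ex_minnP => n fn le_n; split=> // k lt_kn; apply/eqP/negPn/negP => fk.
  by have := le_n k fk; rewrite leqNgt lt_kn.
case/eqP: f_neq0; apply/funext => n; rewrite fps0E; apply/eqP/negPn/negP => fn.
by apply: nex; exists n.
Qed.

(** * The value semigroup *)

(** Describing values by coefficients removes the junk value of [fps_val] at 0:
a nonzero coefficient already makes the series nonzero. *)
Lemma value_semigroupP (K : fieldType) (f : 'I_3 -> fps K) n :
  value_semigroup f n <->
  exists G, vanishes_below n (fps_eval f G) /\ fps_eval f G n != 0.
Proof.
split=> [[G /= /fps_valP GP <-]|[G [G0 Gn]]]; first by exists G.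
exists G => /=; last exact: fps_val_eq.
by apply: contraNneq Gn => ->; rewrite fps0E.
Qed.

Lemma value_semigroup0 (K : fieldType) (f : 'I_3 -> fps K) :
  value_semigroup f 0%N.
Proof.
apply/value_semigroupP; exists 1; rewrite /fps_eval rmorph1; split=> //.
exact: oner_neq0.
Qed.

Lemma value_semigroupD (K : fieldType) (f : 'I_3 -> fps K) a b :
  value_semigroup f a -> value_semigroup f b -> value_semigroup f (a + b)%N.
Proof.
move=> /value_semigroupP[G [G0 Ga]] /value_semigroupP[H [H0 Hb]].
apply/value_semigroupP; exists (G * H); rewrite fps_evalM fpsM_lead //.
by rewrite mulf_neq0 //; split=> //; apply: vanishes_belowM.
Qed.

Lemma value_semigroupMn (K : fieldType) (f : 'I_3 -> fps K) a k :
  value_semigroup f a -> value_semigroup f (k * a)%N.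
Proof.
move=> Sa; elim: k => [|k IHk]; first exact: value_semigroup0.
by rewrite mulSn; apply: value_semigroupD.
Qed.

(** Dividing n by p as q p + r, one has n = (q - r) p + r (p + 1), a legitimate
combination as soon as r <= q, which holds when n is at least p^2. *)
Lemma value_semigroup_cofinite (K : fieldType) (f : 'I_3 -> fps K) p :
  value_semigroup f p -> value_semigroup f p.+1 ->
  finite_set (~` value_semigroup f)%classic.
Proof.
move=> Sp Sp1; have [p0|p_gt0] := posnP p.
  apply: (sub_finite_set _ (finite_set0 nat)) => n [].
  by rewrite -[n]muln1; apply: value_semigroupMn; rewrite -p0.
apply: (sub_finite_set _ (finite_II (p * p))) => n /= Sn.
rewrite ltnNge; apply/negP => le_n; apply: Sn.
have lt_r : (n %% p < p)%N by rewrite ltn_mod.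
have le_q : (p <= n %/ p)%N by rewrite leq_divRL.
have -> : (n = (n %/ p - n %% p) * p + n %% p * p.+1)%N.
  by have := divn_eq n p; nia.
by apply: value_semigroupD; apply: value_semigroupMn.
Qed.

(** * Counting the small values *)

(** The rows have pairwise distinct leading positions.  In a vanishing
combination, the row with the smallest leading position among those that occur
is the only one contributing to that position, so it cannot occur. *)
Lemma rank_triangular (F : fieldType) k N (s : 'I_k -> 'I_N)
    (H : 'M[F]_(k, N)) :
  injective s -> (forall i, H i (s i) != 0) ->
  (forall i (j : 'I_N), (j < s i)%N -> H i j = 0) -> \rank H = k.
Proof.
move=> s_inj Hs H0; apply/eqP/inj_row_free => v vH0.
apply/rowP => i0; rewrite mxE; apply/eqP/negPn/negP => vi0.
case: (@arg_minnP _ i0 (fun i => v 0 i != 0) (fun i => s i) vi0) => i vi le_i.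
have /rowP/(_ (s i)) := vH0; rewrite !mxE (bigD1 i) //= big1 => [|j ne_ji].
  by apply/eqP; rewrite addr0 mulf_neq0.
have [->|vj] := eqVneq (v 0 j) 0; first by rewrite mul0r.
rewrite H0 ?mulr0 // ltn_neqAle le_i // andbT.
by apply: contra ne_ji => /eqP/val_inj/s_inj->.
Qed.

Lemma vanishes_below_prod (K : comNzRingType) r n (f : 'I_n -> fps K)
    (e : 'I_n -> nat) :
  (forall i, vanishes_below r (f i)) ->
  vanishes_below ((\sum_(i < n) e i) * r) (\prod_(i < n) f i ^+ e i).
Proof.
move=> f0; apply: (big_rec2 (fun x (g : fps K) => vanishes_below (x * r) g)).
  by move=> k; rewrite mul0n.
move=> i x g _ g0; rewrite mulnDl; apply: vanishes_belowM => //.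
exact: vanishes_belowX.
Qed.

(** The coefficients below N of elements realizing the values in A form a matrix
H of rank #|A|, whose rows are combinations of the rows of the matrix M of the
monomials of degree at most d. *)
Lemma card_value_semigroup_le (K : fieldType) (f : 'I_3 -> fps K) r d
    (A : {set 'I_(d.+1 * r)}) :
  (forall i, vanishes_below r (f i)) ->
  (forall i, i \in A -> value_semigroup f i) -> (#|A| <= 'C(d.+3, 3))%N.
Proof.
move=> f0 AS; set N := (d.+1 * r)%N in A AS *.
pose T := [set t : 3.-tuple 'I_d.+1 | \sum_(i <- t) i <= d]%N.
have cardT : #|T| = 'C(d.+3, 3) by rewrite card_partial_ord_partitions.
rewrite -cardT.
pose mono (e : 'I_3 -> nat) := \prod_(i < 3) f i ^+ e i.
pose M := \matrix_(i < #|T|, j < N) mono (fun x => tnth (enum_val i) x) j.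
have MP G : ((\row_(j < N) fps_eval f G j) <= M)%MS.
  have -> : \row_(j < N) fps_eval f G j =
      \sum_(u <- msupp G) mcoeff u G *: \row_(j < N) mono u j.
    apply/rowP => j; rewrite mxE summxE /fps_eval /mmap fps_sumE.
    by apply: eq_bigr => u _; rewrite !mxE fpsCME.
  apply: summx_sub => u _; apply: scalemx_sub.
  (* A monomial is a row of M if its degree is at most d, and 0 below N
     otherwise. *)
  have [le_ud|lt_du] := leqP (\sum_(i < 3) u i) d.
    have lt_u i : (u i < d.+1)%N.
      by rewrite ltnS (leq_trans _ le_ud) // (bigD1 i) //= leq_addr.
    pose t := [tuple Ordinal (lt_u i) | i < 3].
    have tT : t \in T.
      rewrite inE big_tuple (eq_bigr (fun i => u i)) // => i _.
      by rewrite tnth_mktuple.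
    have -> : \row_(j < N) mono u j = row (enum_rank_in tT t) M.
      have tu : mono u = mono (fun i => tnth t i).
        by apply: eq_bigr => i _; rewrite tnth_mktuple.
      by apply/rowP => j; rewrite !mxE (enum_rankK_in tT tT) tu.
    exact: row_sub.
  rewrite (_ : \row_j _ = 0) ?sub0mx //; apply/rowP => j; rewrite !mxE.
  apply: (vanishes_below_prod (r := r)) => //.
  by rewrite (leq_trans (ltn_ord j)) // leq_mul2r lt_du orbT.
have /choice[G GP] : forall i : 'I_#|A|, exists G,
    vanishes_below (enum_val i) (fps_eval f G) /\
    fps_eval f G (enum_val i) != 0.
  by move=> i; apply/value_semigroupP/AS/enum_valP.
pose H := \matrix_(i < #|A|, j < N) fps_eval f (G i) j.
have <- : \rank H = #|A|.
  apply: (@rank_triangular _ _ _ (fun i => enum_val i)).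
  - exact: enum_val_inj.
  - by move=> i; rewrite mxE; case: (GP i).
  - by move=> i j lt_j; rewrite mxE; have [G0 _] := GP i; exact: G0 lt_j.
apply: leq_trans (rank_leq_row M); apply: mxrankS; apply/row_subP => i.
by rewrite (_ : row i H = \row_(j < N) fps_eval f (G i) j) //;
  apply/rowP => j; rewrite !mxE.
Qed.

Lemma genus_ge (S : set nat) N B :
  finite_set (~` S)%classic ->
  (forall A : {set 'I_N}, (forall i, i \in A -> S i) -> (#|A| <= B)%N) ->
  (N <= genus S + B)%N.
Proof.
move=> finS leB; pose A := [set i : 'I_N | `[< S i >]].
have leA : (#|A| <= B)%N by apply: leB => i; rewrite inE => /asboolP.
have leC : (#|~: A| <= genus S)%N.
  rewrite cardE -(size_map val); apply: uniq_leq_size => [|n].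
    by rewrite (map_inj_uniq val_inj) enum_uniq.
  case/mapP => i; rewrite mem_enum !inE => /asboolPn nSi ->.
  by rewrite in_fset_set // mem_set.
by rewrite -(card_ord N) -(cardsC A) addnC leq_add.
Qed.

(** * A consecutive value from genericity *)

(** A boolean copy of the generated subfield, on which the closure properties of
subfields can be registered. *)
Definition subfield_pred {K : fieldType} (A : set K) : {pred K} :=
  fun x => x \in generated_subfield A.

Lemma subfield_pred_closed (K : fieldType) (A : set K) :
  GRing.divring_closed (subfield_pred A).
Proof.
split=> [|x y|x y]; rewrite -!topredE /= /subfield_pred ?inE.
- by move=> M [[M1 _ _] _]; apply/set_mem.
- move=> Fx Fy M MA; have [[_ MB _] _] := MA.
  by apply/set_mem/MB; apply/mem_set; [apply: Fx|apply: Fy].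
- move=> Fx Fy M MA; have [[_ _ MV] _] := MA.
  by apply/set_mem/MV; apply/mem_set; [apply: Fx|apply: Fy].
Qed.

HB.instance Definition _ (K : fieldType) (A : set K) :=
  GRing.isDivringClosed.Build K (subfield_pred A) (subfield_pred_closed A).

Lemma sub_generated_subfield (K : fieldType) (A : set K) x :
  A x -> x \in subfield_pred A.
Proof. by move=> Ax; apply/mem_set => M [_]; apply. Qed.

Lemma alg_independent_linear (K : fieldType) (A : set K) (I : Type) (D : set I)
    (a : I -> K) (x y : I) (c d : K) :
  alg_independent (generated_subfield A) D a ->
  D x -> D y -> x <> y -> c \in subfield_pred A -> d \in subfield_pred A ->
  c != 0 -> c * a x + d * a y != 0.
Proof.
move=> indep Dx Dy ne_xy Fc Fd c_neq0; apply/eqP => eq0.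
pose s (j : 'I_2) := if j == 0 then x else y.
have s_inj : injective s.
  move=> i j; rewrite /s; case: (eqVneq i 0) (eqVneq j 0) => [->|i0] [->|j0] //.
  - by move/esym.
  - by move=> _; apply/val_inj; move: i0 j0; case: i j => [[|[]]//?] [[|[]]].
have Fs (j : 'I_2) : D (s j) by rewrite /s; case: ifP.
pose p : mpoly 2 K := c *: mpolyX K (mnm1 0) + d *: mpolyX K (mnm1 1).
have Fp u : generated_subfield A (mcoeff u p).
  apply/set_mem; rewrite -[_ \in _]/(_ \in subfield_pred A).
  by rewrite mcoeffD !mcoeffZ !mcoeffX rpredD // rpredM // rpred_nat.
have p0 : p = 0.
  by apply: (indep 2%N s) => //; rewrite mevalD !mevalZ !mevalXU.
have := congr1 (mcoeff (mnm1 0)) p0.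
rewrite mcoeffD !mcoeffZ !mcoeffXU mcoeff0 eqxx /= mulr1 mulr0 addr0.
by move/eqP; apply/negP.
Qed.

(** The combination used is f_j(r_j)^(b+1) f_i^(a+1) - f_i(r_i)^(a+1) f_j^(b+1),
whose lowest terms cancel.  The next one is a linear form in the second
coefficients of f_i and f_j, and characteristic 0 keeps the factor a + 1 in its
f_i-coefficient nonzero. *)
Lemma generic_value_next (K : fieldType) (f : 'I_3 -> fps K) (r : 'I_3 -> nat)
    (i j : 'I_3) (a b : nat) :
  [pchar K] =i pred0 -> generic_series r f -> i != j ->
  (a.+1 * r i = b.+1 * r j)%N ->
  value_semigroup f (a.+1 * r i).+1.
Proof.
move=> char0 [f_low f_lead indep] ne_ij eq_ab.
have f0 k : vanishes_below (r k) (f k) by exact: f_low.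
pose F := subfield_pred (range (fun k => f k (r k))).
have Ff k : f k (r k) \in F by apply: sub_generated_subfield; exists k.
have nat_neq0 n : n.+1%:R != 0 :> K by have /pcharf0P-> := char0.
pose A := f j (r j) ^+ b.+1; pose B := f i (r i) ^+ a.+1.
have FA : A \in F by rewrite rpredX.
have FB : B \in F by rewrite rpredX.
pose c := A * (a.+1%:R * f i (r i) ^+ a).
pose d := - (B * (b.+1%:R * f j (r j) ^+ b)).
have cd_neq0 : c * f i (r i).+1 + d * f j (r j).+1 != 0.
  apply: (@alg_independent_linear _ _ _ _ _ (i, (r i).+1) (j, (r j).+1) _ _
    indep) => //=.
  - by move=> [eq_ij _]; rewrite eq_ij eqxx in ne_ij.
  - by rewrite !rpredM ?rpredX ?rpred_nat.
  - by rewrite rpredN !rpredM ?rpredX ?rpred_nat.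
  - by rewrite !mulf_neq0 ?expf_neq0.
pose G : mpoly 3 K :=
  A *: mpolyX K (mnm1 i) ^+ a.+1 - B *: mpolyX K (mnm1 j) ^+ b.+1.
have GE : fps_eval f G = fpsC A * f i ^+ a.+1 - fpsC B * f j ^+ b.+1.
  by rewrite /fps_eval /G rmorphB /= !mmapZ !rmorphXn /= !mmapX !mmap1U.
apply/value_semigroupP; exists G; rewrite GE; split=> [k|]; last first.
  rewrite fpsDE fpsNE !fpsCME fpsX_next // eq_ab fpsX_next //.
  by move: cd_neq0; rewrite /c /d mulNr !mulrA.
rewrite ltnS leq_eqVlt fpsDE fpsNE !fpsCME => /predU1P[->|lt_k].
  by rewrite fpsX_lead // eq_ab fpsX_lead // mulrC subrr.
rewrite (vanishes_belowX (r := r i)) // (vanishes_belowX (r := r j)) -?eq_ab //.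
by rewrite !mulr0 subrr.
Qed.

(** * The asymptotic estimate *)

Lemma bin3_natr (R : comNzRingType) d :
  6 * 'C(d.+2, 3)%:R = d%:R * (d%:R + 1) * (d%:R + 2) :> R.
Proof.
have /(congr1 (fun n => n%:R : R)) := bin_ffact d.+2 3.
rewrite !ffactSS ffactn1 natrM mulrC => ->; ring.
Qed.

(** With x := z y, the bounds u > x - 1 and u <= x give
u x^2 / 2 - C >= x^3 / 3 - x^2 - x / 3, and the error is at most
2 x^2 < eps y^3. *)
Lemma cubic_bound (F : realFieldType) (y z eps u C : F) :
  1 <= y -> 1 <= z -> 0 <= u -> u <= z * y -> z * y < u + 1 ->
  6 * C = u * (u + 1) * (u + 2) -> 2 * z ^+ 2 < eps * y ->
  (z ^+ 3 / 3 - eps) * y ^+ 3 + C < u * ((z * y) ^+ 2 / 2).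
Proof.
move=> y_ge1 z_ge1 u_ge0; set x := z * y => le_ux lt_xu CE ltz.
have x_ge1 : 1 <= x by rewrite /x; nra.
have C_le : 6 * C <= x * (x + 1) * (x + 2).
  by rewrite CE !ler_pM ?mulr_ge0 ?lerD2r ?addr_ge0.
have lt_eps : 2 * x ^+ 2 < eps * y ^+ 3.
  have -> : 2 * x ^+ 2 = 2 * z ^+ 2 * y ^+ 2 by rewrite /x; ring.
  have -> : eps * y ^+ 3 = eps * y * y ^+ 2 by ring.
  by rewrite ltr_pM2r // exprn_gt0 // (lt_le_trans ltr01).
have -> : (z ^+ 3 / 3 - eps) * y ^+ 3 = x ^+ 3 / 3 - eps * y ^+ 3.
  by rewrite /x; field.
have : (x - 1) * (x ^+ 2 / 2) <= u * (x ^+ 2 / 2).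
  by rewrite ler_wpM2r ?divr_ge0 ?sqr_ge0 // lerBlDr ltW.
nra.
Qed.

(** The degree bound d is chosen with d + 1 the integer part of sqrt (2 m l). *)
Lemma asymptotic_bound (R : realType) (m : nat) (eps : R) :
  (0 < m)%N -> 0 < eps ->
  exists L : nat, forall l : nat, (0 < l)%N -> (L <= l)%N ->
  exists d : nat,
  ((2 * m%:R) `^ (3 / 2) / 3 - eps) * l%:R `^ (3 / 2) + 'C(d.+3, 3)%:R
    < (d.+1 * (m * l))%:R.
Proof.
move=> m_gt0 eps_gt0.
(* This threshold says 2 (2 m) < eps sqrt l, the hypothesis of [cubic_bound]. *)
exists (Num.truncn ((4 * m%:R / eps) ^+ 2)).+1 => l l_gt0 leL.
have powR32 (y : R) : 0 < y -> y `^ (3 / 2) = Num.sqrt y ^+ 3.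
  by move=> y0; rewrite powRrM powRAC powR12_sqrt ?ltW // powR_mulrn ?sqrtr_ge0.
have l0 : 0 < l%:R :> R by rewrite ltr0n.
have m0 : 0 < m%:R :> R by rewrite ltr0n.
have m1 : 1 <= m%:R :> R by rewrite ler1n.
have l1 : 1 <= l%:R :> R by rewrite ler1n.
rewrite !powR32 //; last by rewrite mulr_gt0.
set y : R := Num.sqrt l%:R; set z : R := Num.sqrt (2 * m%:R).
have y2 : y ^+ 2 = l%:R by rewrite sqr_sqrtr // ltW.
have z2 : z ^+ 2 = 2 * m%:R by rewrite sqr_sqrtr // mulr_ge0 // ltW.
have y_ge0 : 0 <= y by rewrite sqrtr_ge0.
have z_ge0 : 0 <= z by rewrite sqrtr_ge0.
have y_ge1 : 1 <= y by nra.
have z_ge1 : 1 <= z by nra.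
have z2y : 2 * z ^+ 2 < eps * y.
  have : (4 * m%:R / eps) ^+ 2 < y ^+ 2.
    rewrite y2 -truncn_lt_nat //; last first.
      by rewrite exprn_ge0 // divr_ge0 // ltW // mulr_gt0.
  rewrite ltr_sqr ?nnegrE //; last by rewrite divr_ge0 // ltW // mulr_gt0.
  by rewrite ltr_pdivrMr // z2; lra.
pose x : R := z * y.
have x_ge1 : 1 <= x by rewrite /x; nra.
have /andP[leDx ltxD] := truncn_itv (le_trans ler01 x_ge1).
case: (Num.truncn x) leDx ltxD => [|d] leDx ltxD; first by lra.
exists d; rewrite natrM natrM; set u : R := d.+1%:R in leDx ltxD *.
have -> : m%:R * l%:R = (z * y) ^+ 2 / 2.
  by rewrite exprMn z2 y2; field.
apply: cubic_bound => //.
- by rewrite natr1.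
- exact: bin3_natr.
Qed.

Theorem corollary2p7 (R : realType) (m : nat) (eps : R) :
  (0 < m)%N -> 0 < eps ->
  exists L : nat, forall l : nat, (0 < l)%N -> (L <= l)%N ->
  forall f : 'I_3 -> fps R[i],
    generic_series (fun i : 'I_3 => (m * l + i * m)%N) f ->
    ((2 * m%:R) `^ (3 / 2) / 3 - eps) * l%:R `^ (3 / 2)
      < (genus (value_semigroup f))%:R.
Proof.
move=> m_gt0 eps_gt0; have [L LP] := asymptotic_bound m_gt0 eps_gt0.
exists L => l l_gt0 leL f f_gen; have [d ltd] := LP l l_gt0 leL.
have [f_low f_lead _] := f_gen.
have f_ml i : vanishes_below (m * l) (f i).
  by move=> k lt_k; apply: f_low; rewrite ltn_addr.
(* p = (l + 1) m l is l + 1 times the first order and l times the second. *)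
have cofin : finite_set (~` value_semigroup f)%classic.
  apply: (@value_semigroup_cofinite _ _ (l.+1 * (m * l))).
    apply: value_semigroupMn; apply/value_semigroupP.
    exists (mpolyX _ (mnm1 0)); rewrite /fps_eval mmapX mmap1U.
    by split; [exact: f_ml | have := f_lead 0; rewrite addn0].
  have [l' El] : exists l', l = l'.+1 by exists l.-1; rewrite prednK.
  have := @generic_value_next _ _ _ 0 1 l l' (pchar_num _) f_gen.
  by rewrite /= mul0n addn0 mul1n; apply=> //; rewrite -El; lia.
have le_genus := genus_ge cofin
  (fun A => @card_value_semigroup_le _ f (m * l) d A f_ml).
by rewrite -(ltrD2r 'C(d.+3, 3)%:R) (lt_le_trans ltd) // -natrD ler_nat.
Qed.
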